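(* Let $P$ be a nearly reversible irreducible row-stochastic $n\times n$ matrix ($n\ge2$). Then the RLGL algorithm converges exponentially for the greedy Gauss–Southwell and the random rules. That is, let $x_{t+1}=x_t-x_t(I-P)I_{\{i_t\}}$, $y_t=x_t\Pi^{-1/2}$, $r_t=y_t\mathcal{L}_{\mathrm{norm}}$, for an arbitrary $x_0\in\mathbb{R}^n$. (Greedy Gauss–Southwell) If $i_t\in\arg\max_i|r_{t,i}|$ for every $t$, then there exist $C\ge0$ and $q\in(0,1)$ such that $\mathcal{E}(y_t)\le Cq^t$ for all $t\ge0$. (Random) If the $i_t$ are independent and uniformly distributed on $\{1,\dots,n\}$, then there exist $C\ge0$ and $q\in(0,1)$ such that $\mathbb{E}[\mathcal{E}(y_t)]\le Cq^t$ for all $t\ge0$.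
   Context: Vectors are row vectors; $I_{\{i\}}$ is the diagonal matrix with a single $1$ in position $i$. $\pi$ is the unique positive probability row vector with $\pi P=\pi$; $\Pi=\mathrm{diag}(\pi)$; $P^*=\Pi^{-1}P^\top\Pi$. Set $S=\tfrac12\Pi^{1/2}(P+P^* )\Pi^{-1/2}$ (symmetric), $A=\tfrac12\Pi^{1/2}(P-P^* )\Pi^{-1/2}$ (antisymmetric), $\mathcal{L}=I-S$ (symmetrized Laplacian, positive semidefinite), and $\mathcal{L}_{\mathrm{norm}}=I-\Pi^{1/2}P\Pi^{-1/2}=\mathcal{L}-A$. The Poincaré constant $\mu$ is the smallest nonzero eigenvalue of $\mathcal{L}$. The Dirichlet energy is $\mathcal{E}(y)=\tfrac12y\mathcal{L}y^\top$. Let $\kappa_i=\|A_{i,:}\|_2$ (Euclidean norm of the $i$-th row of $A$) and $\eta_\infty=\max_i\kappa_i/\mu$. $P$ is nearly reversible if $\eta_\infty<\frac{1}{2n+\sqrt n}$. Convergence of RLGL is measured by the Dirichlet energy; for random selection rules, in expectation. *)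

(* Defs.v *)
From HB Require Import structures.
From mathcomp Require Import all_boot all_order all_algebra.
From mathcomp Require Import all_classical all_reals all_analysis.
Set Implicit Arguments.
Unset Strict Implicit.
Unset Printing Implicit Defensive.
Import Order.TTheory GRing.Theory Num.Theory.
Local Open Scope classical_set_scope.
Local Open Scope ring_scope.

Section MarkovMatrix.
Variables (R : realType) (n : nat).
Implicit Types (P L : 'M[R]_n) (pi x y : 'rV[R]_n).

Definition row_stochastic P :=
  (forall i j, 0 <= P i j) /\ (forall i, \sum_j P i j = 1).

Definition irreducible_mx P :=
  forall i j, exists2 k : nat, (0 < k)%N & 0 < (P ^+ k) i j.

Definition stationary_distribution P pi :=
  [/\ forall j, 0 < pi 0 j, \sum_j pi 0 j = 1 & pi *m P = pi].

Definition Pi_mx pi : 'M[R]_n := diag_mx pi.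
Definition sqrt_Pi_mx pi : 'M[R]_n := diag_mx (map_mx Num.sqrt pi).

Definition adjoint_mx P pi : 'M[R]_n :=
  invmx (Pi_mx pi) *m P^T *m Pi_mx pi.

Definition S_mx P pi : 'M[R]_n :=
  2^-1 *: (sqrt_Pi_mx pi *m (P + adjoint_mx P pi) *m invmx (sqrt_Pi_mx pi)).

Definition A_mx P pi : 'M[R]_n :=
  2^-1 *: (sqrt_Pi_mx pi *m (P - adjoint_mx P pi) *m invmx (sqrt_Pi_mx pi)).

Definition sym_laplacian P pi : 'M[R]_n := 1%:M - S_mx P pi.

Definition norm_laplacian P pi : 'M[R]_n :=
  1%:M - sqrt_Pi_mx pi *m P *m invmx (sqrt_Pi_mx pi).

Definition smallest_nonzero_eigenvalue L (mu : R) :=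
  [/\ eigenvalue L mu, mu != 0 &
      forall l : R, eigenvalue L l -> l != 0 -> mu <= l].

Definition poincare_constant P pi (mu : R) :=
  smallest_nonzero_eigenvalue (sym_laplacian P pi) mu.

Definition dirichlet_energy P pi y : R :=
  2^-1 * (y *m sym_laplacian P pi *m y^T) 0 0.

Definition kappa P pi (i : 'I_n) : R :=
  Num.sqrt (\sum_j (A_mx P pi i j) ^+ 2).

(* the entries are nonnegative, so the base value 0 does not alter the
   maximum *)
Definition eta_infty P pi (mu : R) : R :=
  (\big[Num.max/0]_i kappa P pi i) / mu.

(* mu is determined by P and pi, so the existential only names it *)
Definition nearly_reversible P pi :=
  exists2 mu : R, poincare_constant P pi mu &
    eta_infty P pi mu < (2 * n%:R + Num.sqrt n%:R)^-1.

Fixpoint rlgl P x0 (i : nat -> 'I_n) (t : nat) : 'rV[R]_n :=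
  if t is t'.+1 then
    let x := rlgl P x0 i t' in
    x - x *m (1%:M - P) *m delta_mx (i t') (i t')
  else x0.

Definition rlgl_y P pi x0 (i : nat -> 'I_n) (t : nat) : 'rV[R]_n :=
  rlgl P x0 i t *m invmx (sqrt_Pi_mx pi).

Definition rlgl_r P pi x0 (i : nat -> 'I_n) (t : nat) : 'rV[R]_n :=
  rlgl_y P pi x0 i t *m norm_laplacian P pi.

Definition greedy_rule P pi x0 (i : nat -> 'I_n) :=
  forall t j, `|rlgl_r P pi x0 i t 0 j| <= `|rlgl_r P pi x0 i t 0 (i t)|.

End MarkovMatrix.

Section UniformSelection.
Context {R : realType} {n : nat} {d : measure_display} {T : measurableType d}.
Variables (Pr : probability T R) (i : nat -> T -> 'I_n).

(* 'I_n carries the discrete sigma-algebra: every subset is an event *)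
Definition random_indices := forall t (B : set 'I_n), measurable (i t @^-1` B).

Definition mutually_independent :=
  forall (J : seq nat) (B : nat -> set 'I_n), uniq J ->
    Pr (\bigcap_(t in [set` J]) (i t @^-1` B t)) =
    (\prod_(t <- J) Pr (i t @^-1` B t))%E.

Definition uniform_indices :=
  forall t (k : 'I_n), Pr (i t @^-1` [set k]) = (n%:R^-1)%:E.

Definition random_rule :=
  [/\ random_indices, mutually_independent & uniform_indices].

End UniformSelection.

(* Main.v *)
(* Write [g = y L], [a = y A] and [r = g - a].  Updating coordinate [i] lowers
   the Dirichlet energy by at least [(g_i ^ 2 - a_i ^ 2) / 2].  The Poincare
   inequality gives [|g| ^ 2 >= 2 mu E(y)] and, as [A] annihilates the kernel of
   [L], spanned by [sqrt pi], it also gives [|a_i| <= eta |g|].  When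
   [3 sqrt n eta < 1], the choice of a maximal [|r_i|] makes [g_i ^ 2 - a_i ^ 2]
   at least a fixed multiple of [|g| ^ 2], and so does averaging over [i]; in
   both cases the energy contracts by a constant factor at every step. *)

Require Import Defs.
From mathcomp Require Import all_boot all_order all_algebra.
From mathcomp Require Import all_classical all_reals all_analysis.
From mathcomp Require Import measurable_realfun ring lra.
Import Order.TTheory GRing.Theory Num.Theory.
Import numFieldNormedType.Exports.
Local Open Scope classical_set_scope.
Local Open Scope ring_scope.

(** * Inner product of row vectors and the Poincaré inequality *)

Section Dot.
Context {R : realType} {n : nat}.
Implicit Types (u v w y s : 'rV[R]_n) (L : 'M[R]_n).

Definition dot u v : R := (u *m v^T) 0 0.

Lemma dotE u v : dot u v = \sum_j u 0 j * v 0 j.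
Proof. by rewrite /dot mxE; apply: eq_bigr => j _; rewrite mxE. Qed.

Lemma dotC u v : dot u v = dot v u.
Proof. by rewrite !dotE; apply: eq_bigr => j _; rewrite mulrC. Qed.

Lemma dotDl u v w : dot (u + v) w = dot u w + dot v w.
Proof. by rewrite /dot mulmxDl mxE. Qed.

Lemma dotZl c u v : dot (c *: u) v = c * dot u v.
Proof. by rewrite /dot -scalemxAl mxE. Qed.

Lemma dotNl u v : dot (- u) v = - dot u v.
Proof. by rewrite /dot mulNmx mxE. Qed.

Lemma dotDr u v w : dot w (u + v) = dot w u + dot w v.
Proof. by rewrite !(dotC w) dotDl. Qed.

Lemma dotZr c u v : dot v (c *: u) = c * dot v u.
Proof. by rewrite !(dotC v) dotZl. Qed.

Lemma dotNr u v : dot v (- u) = - dot v u.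
Proof. by rewrite !(dotC v) dotNl. Qed.

Lemma dot0l u : dot 0 u = 0.
Proof. by rewrite /dot mul0mx mxE. Qed.

Lemma dot_delta u i : dot u (delta_mx 0 i) = u 0 i.
Proof.
rewrite dotE (bigD1 i) //= mxE !eqxx mulr1 big1 ?addr0 // => j ji.
by rewrite mxE (negbTE ji) mulr0.
Qed.

Lemma dot_mul_tr L u v : dot (u *m L) v = dot u (v *m L^T).
Proof. by rewrite /dot trmx_mul trmxK mulmxA. Qed.

Lemma dot_sqr u : dot u u = \sum_j u 0 j ^+ 2.
Proof. by rewrite dotE; apply: eq_bigr => j _; rewrite expr2. Qed.

Lemma dot_ge0 u : 0 <= dot u u.
Proof. by rewrite dot_sqr; apply: sumr_ge0 => j _; rewrite sqr_ge0. Qed.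

Lemma dot_eq0 u : dot u u = 0 -> u = 0.
Proof.
rewrite dot_sqr => /eqP; rewrite psumr_eq0 => [/allP u0|j _]; last first.
  by rewrite sqr_ge0.
apply/rowP => j; rewrite mxE; apply/eqP.
by have := u0 j (mem_index_enum _); rewrite sqrf_eq0.
Qed.

Lemma discriminant_le0 (a b c : R) :
  (forall t, 0 <= a + 2 * b * t + c * t ^+ 2) -> 0 <= c -> b ^+ 2 <= a * c.
Proof.
move=> h; rewrite le_eqVlt => /predU1P[c0|c0].
  have [->|b0] := eqVneq b 0; first by rewrite -c0 expr0n mulr0.
  (* With [c = 0] the polynomial is affine, and at this point it equals [-1]. *)
  have := h (- (a + 1) / (2 * b)); rewrite -c0 mul0r addr0.
  have -> : 2 * b * (- (a + 1) / (2 * b)) = - (a + 1) by field.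
  lra.
(* This is the minimiser of the quadratic. *)
have := h (- b / c).
have -> : a + 2 * b * (- b / c) + c * (- b / c) ^+ 2 = (a * c - b ^+ 2) / c.
  by field; rewrite gt_eqF.
by rewrite pmulr_lge0 ?invr_gt0 // subr_ge0.
Qed.

Lemma cauchy_schwarz u v : dot u v ^+ 2 <= dot u u * dot v v.
Proof.
apply: discriminant_le0 (dot_ge0 v) => t.
have := dot_ge0 (u + t *: v); rewrite !(dotDl, dotDr, dotZl, dotZr) (dotC v u).
by congr (_ <= _); ring.
Qed.

Lemma continuous_dot s : continuous (fun y => dot y s).
Proof.
under eq_fun do rewrite dotE.
apply: continuous_big => [x|j _]; first exact: add_continuous.
move=> y; apply: continuousM; first exact: (@coord_continuous R 1 n).
exact: cst_continuous.
Qed.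

Lemma continuous_quadratic_form L : continuous (fun y => dot (y *m L) y).
Proof.
under eq_fun do rewrite dotE.
apply: continuous_big => [x|j _]; first exact: add_continuous.
move=> y; apply: continuousM; last exact: (@coord_continuous R 1 n).
have -> : (fun z : 'rV[R]_n => (z *m L) 0 j) = (fun z => dot z (row j L^T)).
  apply/funext => z; rewrite dotE mxE.
  by apply: eq_bigr => k _; rewrite !mxE.
exact: continuous_dot.
Qed.

Lemma compact_sphere_orthogonal s :
  compact [set y | dot y y = 1 /\ dot y s = 0].
Proof.
apply: bounded_closed_compact.
  exists 1; split => // M M1 y [y1 _].
  (* The norm here is the maximum norm, and each squared entry is at most [dot y y], which is 1. *)
  rewrite /= [leLHS]/Num.norm /= mx_normrE; apply/bigmax_leP.
  split=> [|[i j] _ /=].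
    by rewrite (le_trans _ (ltW M1)).
  apply: le_trans (ltW M1); rewrite (ord1 i) -(ler_pXn2r (ltn0Sn 1)) ?nnegrE //.
  rewrite -normrX ger0_norm ?sqr_ge0 // expr1n -y1 dot_sqr (bigD1 j) //=.
  by rewrite lerDl sumr_ge0 // => k _; rewrite sqr_ge0.
have -> : [set y | dot y y = 1 /\ dot y s = 0] =
    ((fun y => dot (y *m 1%:M) y) @^-1` [set 1]) `&`
    ((fun y => dot y s) @^-1` [set 0]).
  by apply/seteqP; split => y /=; rewrite mulmx1.
apply: closedI; apply: preimage_closed => [y _|];
  by [exact: continuous_quadratic_form|exact: continuous_dot|exact: closed_eq].
Qed.

(* The Rayleigh quotient attains its minimum on the unit sphere orthogonal to
   [s] at an eigenvector for a nonzero eigenvalue. *)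
Lemma poincare_inequality L s mu y :
  L^T = L -> s *m L = 0 -> (forall u, 0 <= dot (u *m L) u) ->
  (forall u, dot (u *m L) u = 0 -> exists c, u = c *: s) ->
  (forall l, eigenvalue L l -> l != 0 -> mu <= l) ->
  dot y s = 0 -> mu * dot y y <= dot (y *m L) y.
Proof.
move=> Lsym sL Lpsd Lker mu_le ys.
have [->|y0] := eqVneq y 0; first by rewrite mul0mx !dot0l mulr0.
have normalize u : u != 0 -> dot u s = 0 -> exists2 c,
    c != 0 & [set v | dot v v = 1 /\ dot v s = 0] (c *: u).
  move=> u0 us; have uu0 : 0 < dot u u.
    by rewrite lt_def dot_ge0 andbT; apply: contra_neq u0; exact: dot_eq0.
  have := sqr_sqrtr (ltW uu0).
  have : Num.sqrt (dot u u) != 0 by rewrite gt_eqF // sqrtr_gt0.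
  move: (Num.sqrt _) => d d0 d2.
  exists d^-1; first by rewrite invr_eq0.
  rewrite /= !dotZl dotZr us mulr0; split=> //.
  by rewrite -d2; field.
have [|v vK vmin] := compact_EVT_min _ (compact_sphere_orthogonal s)
    (continuous_subspaceT (continuous_quadratic_form L)).
  by have [c _ ?] := normalize y y0 ys; exists (c *: y).
move: vK; rewrite inE => -[v1 vs].
set l := dot (v *m L) v in vmin.
have rayleigh u : dot u s = 0 -> l * dot u u <= dot (u *m L) u.
  have [->|u0 us] := eqVneq u 0; first by rewrite mul0mx !dot0l mulr0.
  have [c c0 cu] := normalize u u0 us.
  have h := vmin (c *: u) (mem_set cu); case: cu => /= cu1 _.
  move: h; rewrite -[l in X in X -> _]mulr1 -cu1 -scalemxAl !dotZl !dotZr => h.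
  have c2 : 0 < c * c by rewrite -expr2 exprn_even_gt0 //= c0.
  by rewrite -(ler_pM2l c2); move: h; congr (_ <= _); ring.
have vLE : v *m L = l *: v.
  (* The residual [w] is orthogonal to [s]. Along [v + t *: w] the Rayleigh inequality is a
     quadratic in [t] with zero constant term and linear coefficient [2 * dot w w], so its
     discriminant forces [w = 0]. *)
  have [w wE] : exists w, w = v *m L - l *: v by exists (v *m L - l *: v).
  have ws : dot w s = 0.
    by rewrite wE dotDl dotNl dotZl vs dot_mul_tr Lsym sL dotC dot0l mulr0 subr0.
  have : dot w w ^+ 2 <= 0 * (dot (w *m L) w - l * dot w w).
    apply: discriminant_le0 => [t|]; last by rewrite subr_ge0 rayleigh.
    have := rayleigh (v + t *: w).
    rewrite !dotDl dotZl vs ws mulr0 addr0 => /(_ erefl).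
    rewrite -subr_ge0 mulmxDl -scalemxAl !(dotDl, dotDr, dotZl, dotZr) -/l v1.
    rewrite (dotC w v).
    have -> : dot (w *m L) v = dot (v *m L) w by rewrite dot_mul_tr Lsym dotC.
    have -> : dot w w = dot (v *m L) w - l * dot v w.
      by rewrite {1}wE dotDl dotNl dotZl.
    by congr (_ <= _); ring.
  rewrite mul0r exprn_even_le0 //= => /eqP /dot_eq0 /eqP.
  by rewrite wE subr_eq0 => /eqP.
have v0 : v != 0.
  by apply: contra_eq_neq v1 => ->; rewrite dot0l eq_sym oner_eq0.
(* If [l = 0], then [v] is a multiple of [s], which contradicts its being a unit vector orthogonal
   to [s]. *)
have l0 : l != 0.
  apply: contra_neq v0 => /Lker[c vc].
  move: v1; rewrite {2}vc dotZr vs mulr0 => /eqP.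
  by rewrite eq_sym oner_eq0.
apply: le_trans (rayleigh y ys); apply: ler_wpM2r; first exact: dot_ge0.
by apply: mu_le => //; apply/eigenvalueP; exists v.
Qed.

End Dot.

(** Taking the index as an argument turns the algorithm into a [foldl] over the list of selected
    indices. *)
Definition rlgl_step {R : realType} {n : nat} (P : 'M[R]_n) (x : 'rV[R]_n)
    (k : 'I_n) : 'rV[R]_n :=
  x - x *m (1%:M - P) *m delta_mx k k.

(** * The symmetrized Laplacian of the chain and the energy change in one step *)

Section Chain.
Context {R : realType} {n : nat} (P : 'M[R]_n) (pi : 'rV[R]_n).
Hypotheses (P_stoch : row_stochastic P) (P_irr : irreducible_mx P)
  (pi_stat : stationary_distribution P pi).
Implicit Types (y : 'rV[R]_n) (i j : 'I_n).

Local Notation s := (map_mx Num.sqrt pi).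
Local Notation T := (sqrt_Pi_mx pi *m P *m invmx (sqrt_Pi_mx pi)).
Local Notation L := (sym_laplacian P pi).
Local Notation A := (A_mx P pi).

Lemma invmx_diag (d : 'rV[R]_n) :
  (forall j, d 0 j != 0) -> invmx (diag_mx d) = diag_mx (map_mx GRing.inv d).
Proof.
move=> d0; have dV : diag_mx d *m diag_mx (map_mx GRing.inv d) = 1%:M.
  apply/matrixP => i j; rewrite mul_diag_mx !mxE.
  by case: eqVneq => [->|_]; rewrite ?mulr1n ?mulr0n ?mulr0 // divff.
have du : diag_mx d \in unitmx by case/mulmx1_unit: dV.
by rewrite -[RHS](mulKmx du) dV mulmx1.
Qed.

Let pi_gt0 j : 0 < pi 0 j. Proof. by case: pi_stat. Qed.

Let sqrt_pi_gt0 j : 0 < Num.sqrt (pi 0 j). Proof. by rewrite sqrtr_gt0. Qed.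

Let sqrt_pi_neq0 j : Num.sqrt (pi 0 j) != 0. Proof. by rewrite gt_eqF. Qed.

Let sqr_sqrt_pi j : Num.sqrt (pi 0 j) ^+ 2 = pi 0 j.
Proof. by rewrite sqr_sqrtr // ltW. Qed.

Let inv_sqrt_Pi : invmx (sqrt_Pi_mx pi) = diag_mx (map_mx GRing.inv s).
Proof. by apply: invmx_diag => j; rewrite mxE. Qed.

Let TE i j : T i j = Num.sqrt (pi 0 i) * P i j / Num.sqrt (pi 0 j).
Proof. by rewrite inv_sqrt_Pi mul_mx_diag mxE mul_diag_mx !mxE. Qed.

(** Conjugation by the square root of [pi] turns the adjoint into a transpose, so [S_mx] and [A] are
    the symmetric and antisymmetric parts of [T]. *)
Let conj_adjoint :
  sqrt_Pi_mx pi *m adjoint_mx P pi *m invmx (sqrt_Pi_mx pi) = T^T.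
Proof.
apply/matrixP => i j; rewrite [RHS]mxE TE inv_sqrt_Pi mul_mx_diag mxE.
rewrite mul_diag_mx mxE /adjoint_mx /Pi_mx invmx_diag; last first.
  by move=> k; rewrite gt_eqF.
rewrite mul_mx_diag mxE mul_diag_mx !mxE.
move: (sqr_sqrt_pi i) (sqr_sqrt_pi j) (sqrt_pi_neq0 i) (sqrt_pi_neq0 j).
move: (Num.sqrt (pi 0 i)) (Num.sqrt (pi 0 j)) => a b <- <- a0 b0.
by field; rewrite a0.
Qed.

Let S_mxE : S_mx P pi = 2^-1 *: (T + T^T).
Proof. by rewrite /S_mx mulmxDr mulmxDl conj_adjoint. Qed.

Let A_mxE : A = 2^-1 *: (T - T^T).
Proof. by rewrite /A_mx mulmxBr mulmxBl conj_adjoint. Qed.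

Let trmx_L : L^T = L.
Proof.
by rewrite /sym_laplacian S_mxE linearB linearZ linearD /= trmx1 trmxK addrC
  [T^T + T]addrC addrC.
Qed.

Let trmx_A : A^T = - A.
Proof. by rewrite A_mxE linearZ linearB /= trmxK -scalerN opprB. Qed.

Let norm_laplacianE : norm_laplacian P pi = L - A.
Proof.
rewrite /norm_laplacian /sym_laplacian S_mxE A_mxE.
by apply/matrixP => i j; rewrite !mxE; field.
Qed.

Let s_unit : dot s s = 1.
Proof.
case: pi_stat => _ <- _; rewrite dotE; apply: eq_bigr => j _.
by rewrite !mxE -expr2 sqr_sqrt_pi.
Qed.

(** This is stationarity of [pi] in scaled form; the transposed identity [sTT] encodes the unit row
    sums. Together they put [s] in the kernels of [L] and [A]. *)
Let sT : s *m T = s.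
Proof.
have /rowP stat : pi *m P = pi by case: pi_stat.
apply/rowP => j; rewrite [LHS]mxE [RHS]mxE; apply: (mulIf (sqrt_pi_neq0 j)).
rewrite -expr2 sqr_sqrt_pi -[RHS]stat mxE mulr_suml; apply: eq_bigr => i _.
by rewrite [s _ _]mxE TE -[pi 0 i in RHS]sqr_sqrt_pi; field.
Qed.

Let sTT : s *m T^T = s.
Proof.
case: P_stoch => _ P1; apply/rowP => j; rewrite [LHS]mxE [RHS]mxE.
rewrite -[RHS]mulr1 -(P1 j) mulr_sumr; apply: eq_bigr => i _.
by rewrite [T^T _ _]mxE [s _ _]mxE TE; field; rewrite !sqrt_pi_neq0.
Qed.

Let sL : s *m L = 0.
Proof.
rewrite /sym_laplacian S_mxE mulmxBr mulmx1 -scalemxAr mulmxDr sT sTT.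
by apply/rowP => j; rewrite !mxE; field.
Qed.

Let sA : s *m A = 0.
Proof. by rewrite A_mxE -scalemxAr mulmxBr sT sTT subrr scaler0. Qed.

(** Put [f = y / sqrt pi] and expand the square. The two pure sums both equal [dot y y], one by the
    unit row sums and the other by stationarity; the cross sum is the quadratic form of [T]. *)
Lemma dirichlet_form y : dot (y *m L) y =
  2^-1 * \sum_i \sum_j pi 0 i * P i j *
    (y 0 i / Num.sqrt (pi 0 i) - y 0 j / Num.sqrt (pi 0 j)) ^+ 2.
Proof.
have /rowP stat : pi *m P = pi by case: pi_stat.
have [_ P1] := P_stoch.
pose f i := y 0 i / Num.sqrt (pi 0 i).
have yf i : y 0 i = f i * Num.sqrt (pi 0 i) by rewrite /f divfK.
have yyE : dot y y = \sum_i pi 0 i * f i ^+ 2.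
  rewrite dotE; apply: eq_bigr => i _.
  by rewrite yf -[pi 0 i in RHS]sqr_sqrt_pi; ring.
have sum1 : \sum_i \sum_j pi 0 i * P i j * f i ^+ 2 = dot y y.
  by rewrite yyE; apply: eq_bigr => i _; rewrite -mulr_suml -mulr_sumr P1 mulr1.
have sum2 : \sum_i \sum_j pi 0 i * P i j * f j ^+ 2 = dot y y.
  rewrite yyE exchange_big; apply: eq_bigr => j _; rewrite -mulr_suml.
  by congr (_ * _); have := stat j; rewrite mxE.
have sum3 : \sum_i \sum_j pi 0 i * P i j * (f i * f j) = dot (y *m T) y.
  rewrite exchange_big dotE; apply: eq_bigr => j _.
  rewrite mxE mulr_suml; apply: eq_bigr => i _.
  by rewrite TE !yf -[pi 0 i in LHS]sqr_sqrt_pi; field.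
have -> : \sum_i \sum_j pi 0 i * P i j * (f i - f j) ^+ 2 =
    dot y y + dot y y - 2 * dot (y *m T) y.
  rewrite -{1}sum1 -sum2 -sum3 mulr_sumr -sumrN -!big_split.
  apply: eq_bigr => i _.
  by rewrite mulr_sumr -sumrN -!big_split; apply: eq_bigr => j _ /=; ring.
rewrite /sym_laplacian S_mxE mulmxBr mulmx1 -scalemxAr mulmxDr.
rewrite dotDl dotNl dotZl dotDl [dot (y *m T^T) y]dot_mul_tr trmxK.
by rewrite [dot y (y *m T)]dotC; field.
Qed.

Lemma dirichlet_form_ge0 y : 0 <= dot (y *m L) y.
Proof.
rewrite dirichlet_form mulr_ge0 ?invr_ge0 //; apply: sumr_ge0 => i _.
apply: sumr_ge0 => j _.
by apply: mulr_ge0; [rewrite mulr_ge0 ?P_stoch.1 // ltW | exact: sqr_ge0].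
Qed.

(** All terms of the sum of squares vanish, so [y / sqrt pi] is constant across each edge of [P],
    then along paths, then everywhere by irreducibility. *)
Lemma dirichlet_form_eq0 y : dot (y *m L) y = 0 -> exists c, y = c *: s.
Proof.
have [P0 _] := P_stoch.
pose f i := y 0 i / Num.sqrt (pi 0 i).
have term_ge0 i j : 0 <= pi 0 i * P i j * (f i - f j) ^+ 2.
  by apply: mulr_ge0; [rewrite mulr_ge0 ?P0 // ltW | exact: sqr_ge0].
rewrite dirichlet_form => /eqP; rewrite mulf_eq0 invr_eq0 pnatr_eq0 /=.
rewrite psumr_eq0 => [/allP f0|i _]; last first.
  by apply: sumr_ge0 => j _; exact: term_ge0.
have edge i j : P i j != 0 -> f i = f j.
  move=> Pij; have /= := f0 i (mem_index_enum _).
  rewrite psumr_eq0 => [/allP /(_ j (mem_index_enum _)) /=|k _]; last exact: term_ge0.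
  by rewrite !mulf_eq0 gt_eqF //= (negbTE Pij) /= orbb subr_eq0 => /eqP.
have path k i j : (P ^+ k) i j != 0 -> f i = f j.
  elim: k i => [|k IH] i.
    by rewrite expr0 mxE; case: (eqVneq i j) => [->|_] //; rewrite eqxx.
  rewrite exprS -mulmxE mxE => Pk.
  have [l] : exists l, P i l * (P ^+ k) l j != 0.
    apply/existsP; apply: contraNT Pk => /existsPn Pk.
    by apply/eqP/big1 => l _; apply/eqP; have := Pk l; rewrite negbK.
  by rewrite mulf_eq0 negb_or => /andP[/edge -> /IH].
have fE i j : f i = f j.
  by have [k _ Pk] := P_irr i j; apply: path (k) _ _ _; rewrite gt_eqF.
(* Here [n] may be 0, in which case any scalar works. *)
case: (pickP 'I_n) => [i0 _|no]; last first.
  by exists 0; apply/rowP => j; have := no j.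
by exists (f i0); apply/rowP => j; rewrite !mxE (fE i0 j) divfK.
Qed.

Lemma poincare_constant_gt0 mu : poincare_constant P pi mu -> 0 < mu.
Proof.
case=> /eigenvalueP[v vL v0] mu0 _; rewrite lt_def mu0 /=.
have vv : 0 < dot v v.
  by rewrite lt_def dot_ge0 andbT; apply: contra_neq v0; exact: dot_eq0.
have := dirichlet_form_ge0 v; rewrite [v *m L]vL dotZl.
by rewrite pmulr_lge0.
Qed.

(** Since [s] lies in both kernels, subtracting the component of [y] along [s] changes none of these
    quantities and makes the Poincaré inequality available. *)
Let orthogonal_part y : exists2 z, [/\ z *m L = y *m L, z *m A = y *m A &
  dot (z *m L) z = dot (y *m L) y] & dot z s = 0.
Proof.
exists (y - dot y s *: s); last by rewrite dotDl dotNl dotZl s_unit mulr1 subrr.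
have zL : (y - dot y s *: s) *m L = y *m L.
  by rewrite mulmxBl -scalemxAl sL scaler0 subr0.
split=> //; first by rewrite mulmxBl -scalemxAl sA scaler0 subr0.
by rewrite zL dotDr dotNr dotZr [dot (_ *m _) s]dot_mul_tr trmx_L sL
  [dot y 0]dotC dot0l mulr0 subr0.
Qed.

(** For [z] orthogonal to [s], Cauchy-Schwarz bounds the squared form by [|z L|^2 |z|^2], and
    Poincaré bounds [mu |z|^2] by the form; cancelling one factor gives the first claim. Chaining
    both, [mu^2 |z|^2 <= |z L|^2], which yields the second. *)
Lemma laplacian_gradient_bound mu y : poincare_constant P pi mu ->
  mu * dot (y *m L) y <= dot (y *m L) (y *m L) /\
  forall i, mu ^+ 2 * (y *m A) 0 i ^+ 2 <=
    kappa P pi i ^+ 2 * dot (y *m L) (y *m L).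
Proof.
move=> mu_pc; have mu_gt0 := poincare_constant_gt0 _ mu_pc.
have [_ _ mu_le] := mu_pc.
have [z [zL zA <-] zs] := orthogonal_part y; rewrite -zL -zA.
have gap := poincare_inequality _ _ _ _ trmx_L sL dirichlet_form_ge0
  dirichlet_form_eq0 mu_le zs.
have CS := cauchy_schwarz (z *m L) z.
have energy_le : mu * dot (z *m L) z <= dot (z *m L) (z *m L).
  have := dirichlet_form_ge0 z; rewrite le_eqVlt => /predU1P[<-|E0].
    by rewrite mulr0 dot_ge0.
  rewrite -(ler_pM2r E0) -mulrA -expr2.
  apply: (le_trans (ler_wpM2l (ltW mu_gt0) CS)).
  by rewrite mulrCA; apply: ler_wpM2l => //; exact: dot_ge0.
split=> // i.
(* Antisymmetry trades column [i] of [A] for its row [i], whose norm is [kappa]. *)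
have -> : (z *m A) 0 i = - dot z (row i A).
  rewrite -[A in LHS]trmxK trmx_A dotE !mxE -sumrN; apply: eq_bigr => j _.
  by rewrite !mxE mulrN.
have kE : kappa P pi i ^+ 2 = dot (row i A) (row i A).
  rewrite sqr_sqrtr; last by apply: sumr_ge0 => j _; rewrite sqr_ge0.
  by rewrite dot_sqr; apply: eq_bigr => j _; rewrite [row i A _ _]mxE.
rewrite sqrrN kE.
apply: (le_trans (ler_wpM2l (sqr_ge0 mu) (cauchy_schwarz z (row i A)))).
rewrite mulrA mulrC; apply: ler_wpM2l; first exact: dot_ge0.
apply: le_trans energy_le.
by rewrite expr2 -mulrA; apply: ler_wpM2l => //; exact: ltW.
Qed.

(** One has [x (I - P) = r Pi^(1/2)] with [r] the scaled residual; on coordinate [i] the factor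
    [sqrt pi_i] cancels against the final rescaling. *)
Lemma rlgl_step_scaled (x : 'rV[R]_n) i :
  let y := x *m invmx (sqrt_Pi_mx pi) in
  rlgl_step P x i *m invmx (sqrt_Pi_mx pi) =
  y - (y *m norm_laplacian P pi) 0 i *: delta_mx 0 i.
Proof.
rewrite /rlgl_step /=; set V := invmx _.
have VU : V *m sqrt_Pi_mx pi = 1%:M.
  rewrite mulVmx // unitmxE det_diag unitfE; apply/prodf_neq0 => j _.
  by rewrite mxE.
rewrite mulmxBl; congr (_ - _).
have -> : x *m (1%:M - P) = x *m V *m norm_laplacian P pi *m sqrt_Pi_mx pi.
  rewrite -[x in LHS]mulmx1 -{1}VU -!mulmxA; congr (_ *m (_ *m _)).
  rewrite /norm_laplacian mulmxBl mulmxBr mul1mx mulmx1; congr (_ - _).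
  by rewrite -!mulmxA VU mulmx1.
move: (x *m V *m _) => r.
rewrite /V inv_sqrt_Pi; apply/rowP => j.
rewrite mul_mx_diag !mxE (bigD1 i) //= big1 => [|k ki]; last first.
  by rewrite !mxE (negbTE ki) mulr0.
rewrite mul_mx_diag !mxE eqxx addr0 /=.
by case: (eqVneq j i) => [->|_]; rewrite ?mulr0 ?mul0r // !mulr1 mulfK.
Qed.

Lemma dirichlet_energy_ge0 y : 0 <= dirichlet_energy P pi y.
Proof. by apply: mulr_ge0 (dirichlet_form_ge0 y); rewrite invr_ge0. Qed.

Lemma norm_laplacian_entry y i :
  (y *m norm_laplacian P pi) 0 i = (y *m L) 0 i - (y *m A) 0 i.
Proof. by rewrite norm_laplacianE mulmxBr [LHS]mxE [X in _ + X]mxE. Qed.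

(* With [g = y L], [a = y A] and [r = g - a], the change of energy
   [- r_i g_i + L_ii r_i ^ 2 / 2] is at most [- (g_i ^ 2 - a_i ^ 2) / 2] since
   [L_ii <= 1]. *)
Lemma dirichlet_energy_step y i :
  dirichlet_energy P pi
    (y - (y *m norm_laplacian P pi) 0 i *: delta_mx 0 i) <=
  dirichlet_energy P pi y -
    2^-1 * ((y *m L) 0 i ^+ 2 - (y *m A) 0 i ^+ 2).
Proof.
rewrite norm_laplacian_entry.
have Lii : L i i <= 1.
  have diagE (M : 'M[R]_n) :
      (1%:M - 2^-1 *: (M + M^T)) i i = 1 - 2^-1 * (M i i + M i i).
    by rewrite !mxE eqxx.
  rewrite /sym_laplacian S_mxE diagE TE gerBl mulr_ge0 ?invr_ge0 //.
  by rewrite addr_ge0 // divr_ge0 ?sqrtr_ge0 // mulr_ge0 ?sqrtr_ge0 // P_stoch.1.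
have Le j : ((delta_mx 0 i : 'rV[R]_n) *m L) 0 j = L i j.
  by rewrite -rowE mxE.
rewrite /dirichlet_energy -![(_ *m _^T) 0 0]/(dot _ _).
rewrite mulmxBl -scalemxAl !(dotDl, dotDr, dotNl, dotNr, dotZl, dotZr).
rewrite [dot (delta_mx 0 i *m L) y]dot_mul_tr trmx_L [dot (delta_mx 0 i) _]dotC.
rewrite !dot_delta Le.
move: ((y *m L) 0 i) ((y *m A) 0 i) => g a.
rewrite -subr_ge0.
(* This product is exactly the difference of the two sides. *)
suff : 0 <= 2^-1 * (g - a) ^+ 2 * (1 - L i i) by congr (_ <= _); field.
apply: mulr_ge0; last by rewrite subr_ge0.
by apply: mulr_ge0 (sqr_ge0 _); rewrite invr_ge0.
Qed.

End Chain.

(** * Lower bounds on the decrease under the two selection rules *)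

Section Decrease.
Context {R : realType} {n : nat}.
Implicit Types (g a : 'rV[R]_n) (eta : R).

Lemma eta_infty_ge0 (P : 'M[R]_n) pi mu : 0 < mu -> 0 <= eta_infty P pi mu.
Proof. by move=> mu0; apply: divr_ge0 (ltW mu0); exact: bigmax_ge_id. Qed.

Lemma kappa_le (P : 'M[R]_n) pi mu i :
  0 < mu -> kappa P pi i ^+ 2 <= eta_infty P pi mu ^+ 2 * mu ^+ 2.
Proof.
move=> mu0; rewrite -exprMn /eta_infty divfK ?gt_eqF //.
rewrite ler_pXn2r ?nnegrE ?sqrtr_ge0 ?bigmax_ge_id //.
exact: le_bigmax.
Qed.

(* [3 sqrt n <= 2 n + sqrt n]. *)
Lemma nearly_reversible_small eta : (0 < n)%N -> 0 <= eta ->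
  eta < (2 * n%:R + Num.sqrt n%:R)^-1 -> 3 * Num.sqrt n%:R * eta < 1 :> R.
Proof.
move=> n0 eta0; have m2 : Num.sqrt n%:R ^+ 2 = n%:R :> R by rewrite sqr_sqrtr.
have m1 : 1 <= Num.sqrt n%:R :> R by rewrite -{1}sqrtr1 ler_sqrt // ler1n.
move: (Num.sqrt _) m2 m1 => m <- m1.
have d0 : 0 < 2 * m ^+ 2 + m by nra.
by rewrite -(ltr_pM2r d0) mulVf ?gt_eqF // => h; nra.
Qed.

(** Write [v = 1 / sqrt n] and [r = g - a]. Some [j] has [|g_j| >= v |g|], so maximality gives
    [|r_i| >= |r_j| >= (v - eta) |g|]. Then [g_i^2 - a_i^2 = r_i^2 + 2 r_i a_i >= |r_i| (|r_i| - 2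
    eta |g|)], whence the factor [v - 3 eta]. *)
Lemma greedy_decrease g a eta i : 0 <= eta -> 3 * Num.sqrt n%:R * eta < 1 ->
  (forall j, a 0 j ^+ 2 <= eta ^+ 2 * dot g g) ->
  (forall j, `|g 0 j - a 0 j| <= `|g 0 i - a 0 i|) ->
  ((Num.sqrt n%:R)^-1 - eta) * ((Num.sqrt n%:R)^-1 - 3 * eta) * dot g g <=
  g 0 i ^+ 2 - a 0 i ^+ 2.
Proof.
move=> eta0 small a_le max_i.
have n0 : (0 < n)%N := leq_ltn_trans (leq0n _) (ltn_ord i).
have m0 : 0 < Num.sqrt n%:R :> R by rewrite sqrtr_gt0 ltr0n.
have n0R : 0 < n%:R :> R by rewrite ltr0n.
set G := Num.sqrt (dot g g); have G0 : 0 <= G := sqrtr_ge0 _.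
have G2 : G ^+ 2 = dot g g by rewrite sqr_sqrtr // dot_ge0.
have a_le' j : `|a 0 j| <= eta * G.
  rewrite -(ler_pXn2r (ltn0Sn 1)) ?nnegrE ?mulr_ge0 //.
  by rewrite exprMn G2 real_normK ?num_real.
have [j gj] : exists j, dot g g <= n%:R * g 0 j ^+ 2.
  apply/existsP; apply: contraT => /existsPn g_lt.
  have : \sum_(j < n) n%:R * g 0 j ^+ 2 < \sum_(j < n) dot g g.
    (* A strict inequality of sums needs a nonempty index set; [i] witnesses it. *)
    apply: ltr_sum => [|j _]; first by apply/hasP; exists i; rewrite ?mem_index_enum.
    by rewrite ltNge g_lt.
  by rewrite -mulr_sumr -dot_sqr sumr_const card_ord -[ltRHS]mulr_natl ltxx.
have gj' : (Num.sqrt n%:R)^-1 * G <= `|g 0 j|.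
  rewrite mulrC ler_pdivrMr // -(ler_pXn2r (ltn0Sn 1)) ?nnegrE ?mulr_ge0 ?sqrtr_ge0 //.
  by rewrite exprMn G2 sqr_sqrtr ?ler0n // real_normK ?num_real // mulrC.
have rj : `|g 0 j| - eta * G <= `|g 0 i - a 0 i|.
  apply: le_trans (max_i j); apply: le_trans (lerB_dist _ _).
  by rewrite lerB // a_le'.
have minv : 3 * eta <= (Num.sqrt n%:R)^-1.
  by rewrite -[leRHS]mul1r ler_pdivlMr // mulrAC ltW.
have := a_le' i; move: (g 0 i) (a 0 i) rj => gi ai rj ai_le.
rewrite -G2; move: ((Num.sqrt _)^-1) minv gj' => v minv gj'.
have -> : gi ^+ 2 - ai ^+ 2 = `|gi - ai| ^+ 2 + 2 * ((gi - ai) * ai).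
  by rewrite real_normK ?num_real //; ring.
have : - (`|gi - ai| * (eta * G)) <= (gi - ai) * ai.
  have : `|(gi - ai) * ai| <= `|gi - ai| * (eta * G) by rewrite normrM ler_wpM2l.
  by rewrite ler_norml => /andP[].
move: ((gi - ai) * ai) => X; set r := `|gi - ai| in rj * => XX.
have r_ge : (v - eta) * G <= r by rewrite mulrBl; lra.
(* The product expands to [r^2 - 2 eta G r - (v - eta) (v - 3 eta) G^2]. *)
have : 0 <= (r - (v - eta) * G) * (r + (v - 3 * eta) * G).
  apply: mulr_ge0; first by rewrite subr_ge0.
  by apply: addr_ge0; [exact: normr_ge0|apply: mulr_ge0; rewrite ?subr_ge0].
nra.
Qed.

Lemma uniform_decrease g a eta :
  (forall j, a 0 j ^+ 2 <= eta ^+ 2 * dot g g) ->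
  (1 - n%:R * eta ^+ 2) * dot g g <= \sum_j (g 0 j ^+ 2 - a 0 j ^+ 2).
Proof.
move=> a_le; rewrite big_split /= sumrN mulrBl mul1r.
apply: lerB; first by rewrite dot_sqr.
rewrite (le_trans (ler_sum _ (fun j _ => a_le j))) //.
by rewrite sumr_const card_ord -[leLHS]mulr_natl mulrA.
Qed.

End Decrease.

(** * Geometric decay, pathwise and summed over index words *)

Lemma contraction_factor {R : realFieldType} (c : R) : 0 < c ->
  exists q : R, [/\ 0 < q, q < 1 & 1 - c <= q].
Proof.
(* The value [1/2] keeps the factor positive when [c >= 1]. *)
move=> c0; exists (Num.max 2^-1 (1 - c)); split.
- by rewrite lt_max invr_gt0 ltr0n.
- by rewrite gt_max invf_lt1 ?ltr1n //= gtrBl.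
- by rewrite le_max lexx orbT.
Qed.

Lemma geometric_decay {R : realFieldType} (E : nat -> R) (q : R) : 0 <= q ->
  (forall t, E t.+1 <= q * E t) -> forall t, E t <= E 0%N * q ^+ t.
Proof.
move=> q0 ES; elim=> [|t IH]; first by rewrite expr0 mulr1.
by apply: (le_trans (ES t)); rewrite exprS mulrCA ler_wpM2l.
Qed.

Lemma sum_tuple_cons {R : pzSemiRingType} {I : finType} t (F : seq I -> R) :
  \sum_(w : t.+1.-tuple I) F w = \sum_k \sum_(w : t.-tuple I) F (k :: w).
Proof.
rewrite pair_big /=.
rewrite (reindex (fun p : I * t.-tuple I => [tuple of p.1 :: p.2])) //=.
exists (fun w => (thead w, [tuple of behead w])) => [[k w] _|w _].
  by congr (_, _); apply/val_inj.
by rewrite [RHS]tuple_eta; apply/val_inj.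
Qed.

(** Splitting off the first letter moves the start to [step x k], so the induction runs over all
    [x]. *)
Lemma sum_foldl_geometric {R : realFieldType} {X : Type} {I : finType}
    (step : X -> I -> X) (f : X -> R) (b : R) : 0 <= b ->
  (forall x, \sum_k f (step x k) <= b * f x) ->
  forall t x, \sum_(w : t.-tuple I) f (foldl step x w) <= b ^+ t * f x.
Proof.
move=> b0 fstep; elim=> [|t IH] x.
  rewrite expr0 mul1r (bigD1 [tuple]) //= big1 ?addr0 // => w.
  by case/eqP; exact: tuple0.
rewrite (sum_tuple_cons t (fun w => f (foldl step x w))) /=.
apply: (le_trans (ler_sum _ (fun k _ => IH (step x k)))).
by rewrite -mulr_sumr exprSr -mulrA ler_wpM2l // exprn_ge0.
Qed.

Lemma rlglE {R : realType} {n : nat} (P : 'M[R]_n) x0 (i : nat -> 'I_n) t :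
  rlgl P x0 i t = foldl (rlgl_step P) x0 [seq i s | s <- iota 0 t].
Proof.
elim: t => [|t IH] //.
have -> : iota 0 t.+1 = iota 0 t ++ [:: t] by rewrite -[t.+1]addn1 iotaD.
by rewrite map_cat foldl_cat -IH.
Qed.

(** * Law of the first [t] random indices *)

Section UniformTrajectory.
Context {R : realType} {n : nat} {d : measure_display} {T : measurableType d}.
Variables (Pr : probability T R) (i : nat -> T -> 'I_n).
Hypothesis i_rule : random_rule Pr i.

Let trajectory t x := [seq i s x | s <- iota 0 t].

(* Taking the tested index [k] as the default value of [nth] avoids the need of
   an inhabitant of ['I_n]; it is irrelevant, as [s < t]. *)
Let letter t (w : t.-tuple 'I_n) (s : nat) : set 'I_n :=
  [set k | nth k w s = k].

(** The event that the first [t] indices spell [w], in the intersection form used by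
    [mutually_independent]. *)
Let cylinder t (w : t.-tuple 'I_n) : set T :=
  \bigcap_(s in [set` iota 0 t]) (i s @^-1` letter t w s).

Let cylinderP t (w : t.-tuple 'I_n) x :
  cylinder t w x <-> trajectory t x = w.
Proof.
have nth_tr k s : (s < t)%N -> nth k (trajectory t x) s = i s x.
  by move=> st; rewrite (nth_map 0%N) ?size_iota // nth_iota.
split=> [cyl|tr s /=].
  apply: (@eq_from_nth _ (i 0%N x)).
    by rewrite size_map size_iota size_tuple.
  rewrite size_map size_iota => s st; rewrite nth_tr //.
  have /= <- : nth (i s x) w s = i s x by apply: cyl; rewrite /= mem_iota.
  by apply: set_nth_default; rewrite size_tuple.
by rewrite mem_iota => st; rewrite /letter /= -tr nth_tr.
Qed.

Let measurable_cylinder t (w : t.-tuple 'I_n) : measurable (cylinder t w).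
Proof.
by apply: bigcap_measurableType => s _; case: i_rule => mi _ _; exact: mi.
Qed.

Let probability_cylinder t (w : t.-tuple 'I_n) :
  Pr (cylinder t w) = (n%:R^-1 ^+ t)%:E.
Proof.
have [_ ind unif] := i_rule.
rewrite /cylinder ind ?iota_uniq //.
rewrite (eq_big_seq (fun=> (n%:R^-1)%:E)) => [|s].
  by rewrite prodEFin big_const_seq count_predT size_iota iter_mulr mulr1.
rewrite mem_iota /= add0n => st.
have -> : letter t w s = [set tnth w (Ordinal st)].
  have lE k : nth k w s = tnth w (Ordinal st) by rewrite [RHS](tnth_nth k).
  by apply/seteqP; split=> k /=; rewrite /letter /= lE => ->.
exact: unif.
Qed.

(** The integrand is a finite sum over words of [F w] times the indicator of a cylinder;
    nonnegativity lets the integral pass through the sum. *)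
Lemma expectation_trajectory t (F : seq 'I_n -> R) : (forall w, 0 <= F w) ->
  ('E_Pr[fun x => F [seq i s x | s <- iota 0 t]] =
   (n%:R^-1 ^+ t * \sum_(w : t.-tuple 'I_n) F w)%R%:E)%E.
Proof.
move=> F0; rewrite unlock.
transitivity (\int[Pr]_x \sum_(w <- index_enum (t.-tuple 'I_n))
    ((F w)%:E * (\1_(cylinder t w) x)%:E))%E.
  apply: eq_integral => x _.
  have tr_size : size (trajectory t x) == t by rewrite size_map size_iota.
  rewrite (bigD1 (Tuple tr_size)) //= big1 => [|w].
    by rewrite adde0 indicE mem_set ?mule1 //; apply/cylinderP.
  move=> wtr; rewrite indicE memNset ?mule0 // => /cylinderP tr.
  by move: wtr; rewrite -val_eqE /= -tr eqxx.
rewrite ge0_integral_sum //; last 2 first.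
- move=> w; apply: measurable_funeM; apply/measurable_EFinP.
  exact: measurable_indic.
- by move=> w x _; rewrite mule_ge0 ?lee_fin.
rewrite mulr_sumr -sumEFin; apply: eq_bigr => w _.
rewrite ge0_integralZl_EFin //; last first.
  by apply/measurable_EFinP; exact: measurable_indic.
by rewrite integral_indic // setIT [X in (_ * X)%E]probability_cylinder -EFinM mulrC.
Qed.

End UniformTrajectory.

(** * Exponential decay of the energy for both rules *)

Theorem corollary1 (R : realType) (n : nat) (P : 'M[R]_n) (pi : 'rV[R]_n)
    (n_ge2 : (2 <= n)%N) (P_stoch : row_stochastic P)
    (P_irr : irreducible_mx P) (pi_stat : stationary_distribution P pi)
    (P_nr : nearly_reversible P pi) (x0 : 'rV[R]_n) :
  (forall i : nat -> 'I_n, greedy_rule P pi x0 i ->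
     exists C q : R, [/\ 0 <= C, 0 < q, q < 1 &
       forall t : nat,
         dirichlet_energy P pi (rlgl_y P pi x0 i t) <= C * q ^+ t]) /\
  (forall (d : measure_display) (T : measurableType d) (Pr : probability T R)
     (i : nat -> T -> 'I_n), random_rule Pr i ->
     exists C q : R, [/\ 0 <= C, 0 < q, q < 1 &
       forall t : nat,
         ('E_Pr [fun w : T =>
            dirichlet_energy P pi (rlgl_y P pi x0 (fun s => i s w) t)]
          <= (C * q ^+ t)%:E)%E]).
Proof.
have [mu mu_pc] := P_nr; set eta := eta_infty P pi mu => eta_lt.
have mu0 := poincare_constant_gt0 _ _ P_stoch pi_stat _ mu_pc.
have eta0 : 0 <= eta := eta_infty_ge0 _ _ _ mu0.
have n0 : (0 < n)%N by exact: ltnW.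
have n0R : 0 < n%:R :> R by rewrite ltr0n.
have small := nearly_reversible_small _ n0 eta0 eta_lt.
have E0 := dirichlet_energy_ge0 _ _ P_stoch pi_stat.
set E := dirichlet_energy P pi in E0 *.
pose g (y : 'rV[R]_n) := y *m sym_laplacian P pi.
pose a (y : 'rV[R]_n) := y *m A_mx P pi.
have gap y : 2 * mu * E y <= dot (g y) (g y).
  have [gE _] := laplacian_gradient_bound _ _ P_stoch P_irr pi_stat _ y mu_pc.
  by move: gE; congr (_ <= _); rewrite /E /dirichlet_energy -/(dot (g y) y); field.
have a_le y j : a y 0 j ^+ 2 <= eta ^+ 2 * dot (g y) (g y).
  have [_ /(_ j) aE] := laplacian_gradient_bound _ _ P_stoch P_irr pi_stat _ y mu_pc.
  rewrite -(ler_pM2l (exprn_gt0 2 mu0)) (le_trans aE) // mulrA.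
  by apply: ler_wpM2r; rewrite ?dot_ge0 // [leRHS]mulrC kappa_le.
have step y i : E (y - (y *m norm_laplacian P pi) 0 i *: delta_mx 0 i) <=
    E y - 2^-1 * (g y 0 i ^+ 2 - a y 0 i ^+ 2).
  exact: dirichlet_energy_step.
split=> [i greedy|d T Pr i i_rule].
- set delta := ((Num.sqrt n%:R)^-1 - eta) * ((Num.sqrt n%:R)^-1 - 3 * eta).
  have delta0 : 0 < delta.
    have m0 : 0 < Num.sqrt n%:R :> R by rewrite sqrtr_gt0.
    have lt3 : 3 * eta < (Num.sqrt n%:R)^-1.
      by rewrite -[ltRHS]mul1r ltr_pdivlMr // mulrAC.
    by apply: mulr_gt0; rewrite subr_gt0 //; lra.
  (* A step lowers the energy by at least [delta |g|^2 / 2], and [gap] makes this at least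
     [delta * mu * E y]. *)
  have [q [q0 q1 q_ge]] := contraction_factor _ (mulr_gt0 delta0 mu0).
  exists (E (rlgl_y P pi x0 i 0)), q; split=> //.
  apply: (geometric_decay (fun t => E (rlgl_y P pi x0 i t))) => [|t]; first exact: ltW.
  set y := rlgl_y P pi x0 i t.
  have -> : rlgl_y P pi x0 i t.+1 =
      y - (y *m norm_laplacian P pi) 0 (i t) *: delta_mx 0 (i t).
    exact: rlgl_step_scaled pi_stat _ _.
  apply: (le_trans (step y (i t))).
  have dec : delta * dot (g y) (g y) <= g y 0 (i t) ^+ 2 - a y 0 (i t) ^+ 2.
    apply: greedy_decrease => // j; have := greedy t j.
    by rewrite /rlgl_r -/y !(norm_laplacian_entry _ _ pi_stat).
  apply: (@le_trans _ _ ((1 - delta * mu) * E y)); last by rewrite ler_wpM2r.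
  have := ler_wpM2l (ltW delta0) (gap y).
  lra.
(* By [small], [sqrt n * eta] is below [1/3]. *)
- have w0 : 0 < 1 - n%:R * eta ^+ 2.
    rewrite subr_gt0; have <- : Num.sqrt n%:R ^+ 2 = n%:R :> R by rewrite sqr_sqrtr.
    rewrite -exprMn; have : 0 <= Num.sqrt n%:R * eta by rewrite mulr_ge0.
    move: small; rewrite -mulrA; move: (_ * eta) => z; nra.
  have [q [q0 q1 q_ge]] := contraction_factor _ (divr_gt0 (mulr_gt0 w0 mu0) n0R).
  pose V := invmx (sqrt_Pi_mx pi); pose f x := E (x *m V).
  (* The sum over indices is bounded instead of the mean; the factor [n] per step cancels against
     the probability [n^-t] of each word. *)
  have f_step x : \sum_k f (rlgl_step P x k) <= n%:R * q * f x.
    set y := x *m V.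
    have -> : \sum_k f (rlgl_step P x k) =
        \sum_k E (y - (y *m norm_laplacian P pi) 0 k *: delta_mx 0 k).
      by apply: eq_bigr => k _; rewrite /f rlgl_step_scaled.
    apply: (le_trans (ler_sum _ (fun k _ => step y k))).
    rewrite big_split /= sumrN sumr_const card_ord -[X in _ - X]mulr_sumr.
    have := uniform_decrease _ _ _ (a_le y).
    rewrite -[E y *+ n]mulr_natl; move: (\sum_j _) => D decD.
    apply: (@le_trans _ _ (n%:R * (1 - (1 - n%:R * eta ^+ 2) * mu / n%:R) * E y)).
      have -> : n%:R * (1 - (1 - n%:R * eta ^+ 2) * mu / n%:R) * E y =
          n%:R * E y - (1 - n%:R * eta ^+ 2) * mu * E y.
        by field; rewrite gt_eqF.
      have := ler_wpM2l (ltW w0) (gap y). lra.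
    by apply: ler_wpM2r; [exact: E0|rewrite ler_pM2l].
  exists (f x0), q; split=> // [|t]; first exact: E0.
  have -> : (fun x => E (rlgl_y P pi x0 (fun s => i s x) t)) =
      (fun x => f (foldl (rlgl_step P) x0 [seq i s x | s <- iota 0 t])).
    by apply/funext => x; rewrite /rlgl_y rlglE.
  rewrite (expectation_trajectory _ _ i_rule t (fun w => f (foldl _ x0 w))); last first.
    by move=> w; exact: E0.
  rewrite lee_fin.
  have nq0 : 0 <= n%:R * q by rewrite mulr_ge0 ?ltW.
  apply: (le_trans (ler_wpM2l _ (sum_foldl_geometric _ _ _ nq0 f_step t x0))).
    by rewrite exprn_ge0 // invr_ge0 ltW.
  move: (f x0) => E_0.
  by rewrite mulrA -exprMn mulrA mulVf ?gt_eqF // mul1r mulrC.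
Qed.
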